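(* Let $X$ be a finite nonempty set. The order complex $$\triangle\bigl(\operatorname{Bip}(X)\setminus\{\emptyset,X\times X\}\bigr)$$ is homotopy equivalent to a sphere of dimension $|X|-2$.
   Context: A relation $U\subseteq X\times X$ on a finite set $X$ is bipartitional if both $U$ and $(X\times X)\setminus U$ are transitive. $\operatorname{Bip}(X)$ is the set of bipartitional relations on $X$, partially ordered by inclusion; its minimum is $\emptyset$ and its maximum is $X\times X$. The order complex $\triangle(Q)$ of a poset $Q$ is the simplicial complex whose vertices are the elements of $Q$ and whose faces are the chains of $Q$. By convention, the sphere of dimension $-1$ is the empty space (the complex whose only face is the empty face). *)

(* Defs.v *)
From HB Require Import structures.
From mathcomp Require Import all_boot all_order all_algebra.
From mathcomp Require Import all_classical all_reals topology normedtype.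

Set Implicit Arguments.
Unset Strict Implicit.
Unset Printing Implicit Defensive.

Import Order.TTheory GRing.Theory Num.Theory.
Import numFieldNormedType.Exports.
Import Order.DefaultSetSubsetOrder.

Local Open Scope classical_set_scope.
Local Open Scope ring_scope.

Definition bipartitional (X : finType) (U : {set X * X}) : Prop :=
  transitive [rel x y | (x, y) \in U] /\ transitive [rel x y | (x, y) \in ~: U].

Record bip (X : finType) := Bip {
  bip_rel :> {set X * X};
  bip_relP : `[< bipartitional bip_rel >] }.

HB.instance Definition _ (X : finType) := [isSub for @bip_rel X].
HB.instance Definition _ (X : finType) := [Finite of bip X by <:].
(* With [Order.DefaultSetSubsetOrder], the order on [{set _}] is inclusion. *)
HB.instance Definition _ (X : finType) :=
  [SubChoice_isSubPOrder of bip X by <: with Order.SetSubsetOrder.subset_display].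

Definition proper_part_bip (X : finType) : {set bip X} :=
  [set U : bip X | (val U != finset.set0) && (val U != finset.setT)]%SET.

(* A finite abstract simplicial complex is given by its set of faces, the empty
   face included. *)
Definition order_complex (d : Order.disp_t) (P : finPOrderType d)
    (Q : {set P}) : {set {set P}} :=
  [set c : {set P} | (c \subset Q) &&
     [forall x in c, forall y in c, (x >=< y)%O]]%SET.

(* Barycentric coordinates: nonnegative weights on the vertices, with sum 1 and
   with support a face; in particular the complex whose only face is the empty
   face has an empty realization.  The topology is induced by the product
   topology on functions from [V] to [R], which is Euclidean as [V] is finite. *)
Definition geometric_realization (R : realType) (V : finType)
    (K : {set {set V}}) : topologicalType :=
  set_type [set w : prod_topology (fun _ : V => R) |
    [/\ forall v, 0 <= w v, \sum_v w v = 1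
      & [set v | w v != 0]%SET \in K]].

(* The unit sphere of R^n, of dimension n - 1; it is empty for n = 0.  It is not
   stated with the norm of ['rV[R]_n], which is the sup norm. *)
Definition unit_sphere (R : realType) (n : nat) : topologicalType :=
  set_type [set x : 'rV[R]_n | \sum_(i < n) x 0 i ^+ 2 = 1].

Definition homotopic (R : realType) (S T : topologicalType) (f g : S -> T) :=
  exists H : S * R -> T,
    [/\ {within [set: S] `*` `[0, 1], continuous H},
        forall x, H (x, 0) = f x & forall x, H (x, 1) = g x].

Definition homotopy_equivalent (R : realType) (S T : topologicalType) :=
  exists f : S -> T, exists g : T -> S,
    [/\ continuous f, continuous g,
        homotopic R (g \o f) id & homotopic R (f \o g) id].

(* Main.v *)
(* Give an element [x] of [X] in a bipartitional relation [U] the score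
   outdegree minus indegree.  Averaging the scores over a chain with barycentric
   weights [w] gives a nonconstant function on [X], because along a chain two
   elements are never ordered in opposite ways; modulo constants and scaling this
   is a point of the sphere of dimension [#|X| - 2].  Conversely a nonconstant
   function [v] on [X] gives a weighted chain of bipartitional relations contained
   in [{(x, y) | v y < v x}].  Going from the sphere and back, the two functions
   both increase from [y] to [x] for some pair [(x, y)], so the segment joining
   them avoids the constants.  Going from the complex and back, all relations
   obtained lie below the maximum of the support of [w].  A self-map [q] with this
   property is homotopic to the identity: cut [w] at its median; [q] of the lower
   half and the upper half together span a chain, hence can be joined linearly. *)
Require Import Defs.
From mathcomp Require Import all_boot all_order all_algebra.
From mathcomp Require Import all_classical all_reals topology normedtype.
From mathcomp Require Import realfun.
From mathcomp Require Import lra.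

Set Implicit Arguments.
Unset Strict Implicit.
Unset Printing Implicit Defensive.

Import Order.TTheory GRing.Theory Num.Theory.
Import numFieldNormedType.Exports.
Import Order.DefaultSetSubsetOrder.

Local Open Scope classical_set_scope.
Local Open Scope ring_scope.

(** * Continuity of real-valued functions *)

Section RealContinuity.
Context {R : realType} {T : topologicalType}.
Implicit Types f g : T -> R.

Lemma continuous_add f g :
  continuous f -> continuous g -> continuous (fun x => f x + g x).
Proof. by move=> cf cg x; apply: cvgD; [apply: cf|apply: cg]. Qed.

Lemma continuous_mul f g :
  continuous f -> continuous g -> continuous (fun x => f x * g x).
Proof. by move=> cf cg x; apply: cvgM; [apply: cf|apply: cg]. Qed.

Lemma continuous_sub f g :
  continuous f -> continuous g -> continuous (fun x => f x - g x).
Proof. by move=> cf cg x; apply: cvgB; [apply: cf|apply: cg]. Qed.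

Lemma continuous_div f g : (forall x, g x != 0) ->
  continuous f -> continuous g -> continuous (fun x => f x / g x).
Proof.
move=> g0 cf cg x; apply: cvgM; first exact: cf.
by apply: cvgV; [exact: g0|exact: cg].
Qed.

Lemma continuous_maxr f g :
  continuous f -> continuous g -> continuous (fun x => Num.max (f x) (g x)).
Proof.
by move=> cf cg x; apply: (@continuous_max R T f g x); [apply: cf|apply: cg]. Qed.

Lemma continuous_sumr (I : Type) (r : seq I) (P : pred I) (F : I -> T -> R) :
  (forall i, P i -> continuous (F i)) ->
  continuous (fun x => \sum_(i <- r | P i) F i x).
Proof. apply: continuous_big; exact: add_continuous. Qed.

Lemma continuous_prodr (I : Type) (r : seq I) (P : pred I) (F : I -> T -> R) :
  (forall i, P i -> continuous (F i)) ->
  continuous (fun x => \prod_(i <- r | P i) F i x).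
Proof. apply: continuous_big; exact: mul_continuous. Qed.

Lemma continuous_bigmaxr (I : Type) (r : seq I) (P : pred I) (F : I -> T -> R) x0 :
  (forall i, P i -> continuous (F i)) ->
  continuous (fun x => \big[Num.max/x0]_(i <- r | P i) F i x).
Proof.
apply: continuous_big => z.
by apply: (@continuous_max R (R * R)%type fst snd); [exact: cvg_fst|exact: cvg_snd].
Qed.
End RealContinuity.

(** * Maps into geometric realizations and spheres *)

Definition bary (R : realType) (V : finType) (K : {set {set V}})
  (p : geometric_realization R K) (v : V) : R := sval p v.

Section Realization.
Context {R : realType} {V : finType} {K : {set {set V}}}.
Local Notation T := (geometric_realization R K).

Lemma bary_ge0 (p : T) v : 0 <= bary p v.
Proof. by case: p => w /= /set_mem[]. Qed.

Lemma sum_bary (p : T) : \sum_v bary p v = 1.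
Proof. by case: p => w /= /set_mem[]. Qed.

Lemma supp_bary (p : T) : [set v | bary p v != 0]%SET \in K.
Proof. by case: p => w /= /set_mem[]. Qed.

Lemma bary_inj (p q : T) : bary p =1 bary q -> p = q.
Proof. by move=> pq; apply: val_inj; apply: funext => v; exact: pq. Qed.

Lemma bary_continuous v : continuous (fun p : T => bary p v).
Proof.
move=> p; apply: (@continuous_comp T (prod_topology (fun _ : V => R)) R sval
  (fun w => w v)).
  exact: initial_continuous.
exact: (@proj_continuous V (fun _ => R) v).
Qed.

(** Dividing by the positive total changes no support, so later constructions may use weights whose
    sum is not 1. *)
Lemma realization_map (Y : topologicalType) (a : Y -> V -> R) :
  (forall v, continuous (a ^~ v)) -> (forall y v, 0 <= a y v) ->
  (forall y, exists v, a y v != 0) ->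
  (forall y, [set v | a y v != 0]%SET \in K) ->
  exists2 h : Y -> T, continuous h &
    forall y v, bary (h y) v = a y v / \sum_u a y u.
Proof.
move=> ca a0 aN0 aK.
have s0 y : 0 < \sum_u a y u.
  have [v av] := aN0 y.
  rewrite (bigD1 v) //= ltr_wpDr ?sumr_ge0 // lt_def av; exact: a0.
pose S := [set w : prod_topology (fun _ : V => R) |
    [/\ forall v, 0 <= w v, \sum_v w v = 1
      & [set v | w v != 0]%SET \in K]].
have hP y : S (fun v => a y v / \sum_u a y u).
  split=> [v||]; first by rewrite divr_ge0 // ltW.
    by rewrite -mulr_suml divff // gt_eqF.
  suff -> : [set v | a y v / \sum_u a y u != 0]%SET =
      [set v | a y v != 0]%SET by [].
  by apply/setP => v; rewrite !inE mulf_eq0 invr_eq0 (gt_eqF (s0 y)) orbF.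
exists (fun y => exist (fun w => w \in S) _ (mem_set (hP y))) => // y.
apply: continuous_comp_initial => {}y.
(* The product topology is the supremum of the initial topologies of the projections, so each
   coordinate is checked separately. *)
apply/cvg_sup => v; move: y; apply: continuous_comp_initial.
apply: continuous_div => // [y|]; first by rewrite gt_eqF.
by apply: continuous_sumr => u _; exact: ca.
Qed.
End Realization.

Lemma sphere_map (R : realType) (n : nat) (Y : topologicalType) (a : Y -> 'I_n -> R) :
  (forall i, continuous (a ^~ i)) -> (forall y, exists i, a y i != 0) ->
  exists2 h : Y -> unit_sphere R n, continuous h &
    forall y i, sval (h y) 0 i = a y i / Num.sqrt (\sum_j a y j ^+ 2).
Proof.
move=> ca aN0.
have s0 y : 0 < \sum_j a y j ^+ 2.
  have [i ai] := aN0 y.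
  by rewrite (bigD1 i) //= ltr_wpDr ?exprn_even_gt0 ?sumr_ge0 // => j _; rewrite sqr_ge0.
pose S := [set x : 'rV[R]_n | \sum_(i < n) x 0 i ^+ 2 = 1].
have hP y : S (\row_i (a y i / Num.sqrt (\sum_j a y j ^+ 2))).
  rewrite /S /=; under eq_bigr => i _ do rewrite mxE expr_div_n sqr_sqrtr ?ltW//.
  by rewrite -mulr_suml divff // gt_eqF.
exists (fun y => exist (fun w => w \in S) _ (mem_set (hP y)));
  last by move=> y i; rewrite /= mxE.
apply: continuous_comp_initial => y U [P Py PU] /=.
apply: filterS.
  by move=> z Pz; apply: PU; exact: Pz.
rewrite /=; apply: filter_forall => i; apply: filter_forall => j; apply: filterS.
  by move=> z Pz; rewrite mxE; exact: Pz.
move: (Py i j); rewrite /= mxE.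
suff cn : continuous (fun y => a y j / Num.sqrt (\sum_k a y k ^+ 2)) by exact: cn.
apply: continuous_div => // [z|]; first by rewrite gt_eqF // sqrtr_gt0.
move=> z; apply: (@continuous_comp _ R R); last exact: sqrt_continuous.
apply: continuous_sumr => k _; under eq_fun do rewrite expr2.
exact: continuous_mul.
Qed.

Lemma sphere_coord_continuous (R : realType) n (i : 'I_n) :
  continuous (fun x : unit_sphere R n => sval x 0 i).
Proof.
move=> x; apply: (@continuous_comp (unit_sphere R n) 'rV[R]_n R sval
  (fun w : 'rV[R]_n => w 0 i)).
  exact: initial_continuous.
exact: coord_continuous.
Qed.

(** * Order complexes and deformation of self-maps to the identity *)

Lemma order_complexP (d : Order.disp_t) (P : finPOrderType d) (Q c : {set P}) :
  reflect ({subset c <= Q} /\ {in c &, forall x y, (x >=< y)%O})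
    (c \in order_complex Q).
Proof.
rewrite inE; apply: (iffP andP) => -[/fintype.subsetP cQ cc]; split=> //.
  by move=> x y xc yc; move/forall_inP/(_ x xc)/forall_inP: cc; apply.
by apply/forall_inP => x xc; apply/forall_inP => y yc; exact: cc.
Qed.

Lemma order_complexS (d : Order.disp_t) (P : finPOrderType d) (Q c c' : {set P}) :
  c' \subset c -> c \in order_complex Q -> c' \in order_complex Q.
Proof.
move=> /fintype.subsetP c'c /order_complexP[cQ cc]; apply/order_complexP.
by split=> [x /c'c/cQ //|x y /c'c xc /c'c yc]; exact: cc.
Qed.

(** Choose [m] with the fewest elements of [S] below it: by transitivity and irreflexivity, an
    element of [S] below [m] would have strictly fewer. *)
Lemma exists_minimal (V : finType) (r : rel V) (S : {set V}) (x : V) :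
  irreflexive r -> transitive r -> x \in S ->
  exists2 m, m \in S & forall y, y \in S -> ~~ r y m.
Proof.
move=> ri rt xS; pose below y := [set z in S | r z y]%SET.
case: (@arg_minnP V x (mem S) (fun y => #|below y|) xS) => m mS mmin.
exists m => // y yS; apply/negP => rym.
have := mmin y yS; rewrite leqNgt => /negP; apply; apply: proper_card.
apply/properP; split.
  by apply/fintype.subsetP => z; rewrite !inE => /andP[-> /rt]; apply.
by exists y; rewrite !inE ?yS ?rym // ri andbF.
Qed.

Lemma exists_bary_neq0 (R : realType) (V : finType) (K : {set {set V}})
  (p : geometric_realization R K) : exists v, bary p v != 0.
Proof.
apply: contrapT => /forallNP N.
have := sum_bary p; rewrite big1 => [/esym/eqP|v _]; first by rewrite oner_eq0.
by have /negP := N v; rewrite negbK => /eqP.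
Qed.

(* For [3 * t >= 1] only the vertices of [w] having mass less than 1/2 strictly
   on their [r]-small side survive. *)
Lemma median_deformation (R : realType) (V : finType) (K : {set {set V}}) (r : rel V) :
  (forall c c' : {set V}, c' \subset c -> c \in K -> c' \in K) ->
  irreflexive r -> transitive r ->
  exists2 h : geometric_realization R K * R -> geometric_realization R K,
    continuous h &
    [/\ forall w, h (w, 0) = w,
        forall w t v, bary (h (w, t)) v != 0 -> bary w v != 0 &
        forall w t v, 1 <= 3 * t -> bary (h (w, t)) v != 0 ->
          \sum_(u | r u v) bary w u < 2^-1].
Proof.
move=> KS ri rt; set T := geometric_realization R K.
pose m (w : T) v := \sum_(u | r u v) bary w u.
(* The first summand is the only one at time 0 and vanishes once [3 * t >= 1]; the second kills the
   vertices with [m] at least 1/2. The truncations at 0 keep the weights nonnegative for every real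
   time. *)
pose a (y : T * R) v := bary y.1 v *
  (Num.max 0 (1 - 3 * y.2) + Num.max 0 y.2 * Num.max 0 (2^-1 - m y.1 v)).
have cb v : continuous (fun y : T * R => bary y.1 v).
  move=> y; apply: (@continuous_comp (T * R)%type T R fst (fun w => bary w v)).
    exact: cvg_fst.
  exact: bary_continuous.
have c2 : continuous (fun y : T * R => y.2) by move=> y; exact: cvg_snd.
have ck (k : R) : continuous (fun y : T * R => k) by exact: cst_continuous.
have ca v : continuous (a ^~ v).
  apply: continuous_mul => //; apply: continuous_add.
    by apply: continuous_maxr => //; apply: continuous_sub => //; exact: continuous_mul.
  apply: continuous_mul; apply: continuous_maxr => //; apply: continuous_sub => //.
  exact: continuous_sumr.
have a0 y v : 0 <= a y v.
  by rewrite mulr_ge0 ?bary_ge0 // addr_ge0 ?mulr_ge0 // le_max lexx.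
have aN0 y : exists v, a y v != 0.
  case: y => w t; have [x wx] := exists_bary_neq0 w.
  have xS : x \in [set u | bary w u != 0]%SET by rewrite inE.
  (* An [r]-minimal vertex of the support has [m] equal to 0, so it keeps a positive weight at all
     times. *)
  have [v] := exists_minimal ri rt xS.
  rewrite inE => wv vmin; exists v.
  rewrite /a /= mulf_neq0 // gt_eqF // /m big1 => [|u ruv]; last first.
    by have := vmin u; rewrite inE ruv; case: eqP => // _ /(_ isT).
  rewrite subr0 (@max_r _ _ 0 2^-1) ?invr_ge0 //.
  have [t0|t0] := leP t 0.
    by rewrite mul0r addr0 lt_max; apply/orP; right; lra.
  by rewrite ltr_wpDl ?mulr_gt0 ?invr_gt0 // le_max lexx.
have supp y : [set v | a y v != 0]%SET \in K.
  apply: KS (supp_bary y.1); apply/fintype.subsetP => v; rewrite !inE.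
  by apply: contraNneq => av; rewrite /a av mul0r.
have [h ch hE] := realization_map ca a0 aN0 supp.
have hN0 w t v : bary (h (w, t)) v != 0 -> a (w, t) v != 0.
  by rewrite hE mulf_eq0 negb_or => /andP[].
exists h => //; split.
- move=> w; apply: bary_inj => v; rewrite hE.
  have aw u : a (w, 0) u = bary w u.
    by rewrite /a /= mulr0 subr0 maxxx mul0r addr0 max_r // mulr1.
  by rewrite aw (eq_bigr (bary w)) // sum_bary divr1.
- by move=> w t v /hN0; apply: contraNneq => wv; rewrite /a /= wv mul0r.
- move=> w t v t1 /hN0; rewrite ltNge; apply: contraNN => mv.
  rewrite /a /= (@max_l _ _ 0 (1 - 3 * t)) ?subr_le0 //.
  by rewrite (@max_l _ _ 0 (2^-1 - m w v)) ?subr_le0 // mulr0 addr0 mulr0.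
Qed.

Lemma continuous_homotopic (R : realType) (S T : topologicalType) (f g : S -> T)
    (H : S * R -> T) :
  continuous H -> (forall x, H (x, 0) = f x) -> (forall x, H (x, 1) = g x) ->
  homotopic R f g.
Proof. by move=> cH H0 H1; exists H; split=> //; exact: continuous_subspaceT. Qed.

Lemma dominated_homotopic_id (R : realType) (d : Order.disp_t) (P : finPOrderType d)
    (Q : {set P}) (T := geometric_realization R (order_complex Q)) (q : T -> T) :
  continuous q ->
  (forall w v, bary (q w) v != 0 -> exists2 u, bary w u != 0 & (v <= u)%O) ->
  homotopic R q id.
Proof.
move=> cq qle.
have KS (c c' : {set P}) := @order_complexS d P Q c c'.
have [h1 ch1 [h10 h1s h1m]] := @median_deformation R P _ (fun x y : P => (x < y)%O)
  KS (@ltxx _ _) (@lt_trans _ _).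
have [h2 ch2 [h20 h2s h2m]] := @median_deformation R P _ (fun x y : P => (y < x)%O)
  KS (@ltxx _ _) (fun y x z xy yz => lt_trans yz xy).
(* For [t] in [0, 1/3] and in [2/3, 1] only one summand is present, and its
   argument is deformed to or from a half of [w]; in between the argument [h1] is in
   the lower half, [h2] in the upper half, and the two summands are mixed. *)
pose a (y : T * R) v := Num.max 0 (2 - 3 * y.2) * bary (q (h1 y)) v +
  Num.max 0 (3 * y.2 - 1) * bary (h2 (y.1, 1 - y.2)) v.
have c2 : continuous (fun y : T * R => y.2) by move=> y; exact: cvg_snd.
have ck (k : R) : continuous (fun y : T * R => k) by exact: cst_continuous.
have ca v : continuous (a ^~ v).
  apply: continuous_add; apply: continuous_mul.
  - by apply: continuous_maxr => //; apply: continuous_sub => //; exact: continuous_mul.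
  - move=> y; apply: (@continuous_comp _ T _ (q \o h1) (fun w => bary w v)).
      by apply: continuous_comp; [exact: ch1|exact: cq].
    exact: bary_continuous.
  - by apply: continuous_maxr => //; apply: continuous_sub => //; exact: continuous_mul.
  - move=> y; apply: (@continuous_comp _ T _ (fun z : T * R => h2 (z.1, 1 - z.2))
      (fun w => bary w v)); last exact: bary_continuous.
    apply: (@continuous_comp _ (T * R)%type _ (fun z : T * R => (z.1, 1 - z.2)) h2).
      have c12 : continuous (fun z : T * R => 1 - z.2) by exact: continuous_sub.
      by apply: (@cvg_pair _ _ _ (nbhs y) (nbhs y.1) (nbhs (1 - y.2)));
        [exact: cvg_fst|exact: c12].
    exact: ch2.
have a0 y v : 0 <= a y v.
  by rewrite addr_ge0 // mulr_ge0 ?bary_ge0 // le_max lexx.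
have aP w t v : a (w, t) v != 0 ->
    (3 * t < 2 /\ bary (q (h1 (w, t))) v != 0) \/
    (1 < 3 * t /\ bary (h2 (w, 1 - t)) v != 0).
  rewrite /a /=; have [->|b1] := eqVneq (bary (q (h1 (w, t))) v) 0.
    rewrite mulr0 add0r mulf_eq0 negb_or => /andP[m0 ->]; right; split=> //.
    by rewrite ltNge; apply: contraNN m0 => tle; rewrite max_l // subr_le0.
  have [t2|t2] := ltP (3 * t) 2; first by left.
  rewrite max_l ?subr_le0 // mul0r add0r mulf_eq0 negb_or => /andP[_ ->].
  by right; split=> //; lra.
have aN0 y : exists v, a y v != 0.
  case: y => w t; have [t2|t2] := ltP (3 * t) 2.
    have [v bv] := exists_bary_neq0 (q (h1 (w, t))); exists v.
    rewrite gt_eqF // ltr_wpDr ?mulr_ge0 ?bary_ge0 ?le_max ?lexx //=.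
    by rewrite mulr_gt0 // ?lt_max ?subr_gt0 ?t2 ?orbT // lt_def bv bary_ge0.
  have [v bv] := exists_bary_neq0 (h2 (w, 1 - t)); exists v.
  rewrite gt_eqF // ltr_wpDl ?mulr_ge0 ?bary_ge0 ?le_max ?lexx //=.
  rewrite mulr_gt0 // ?lt_max ?subr_gt0; last by rewrite lt_def bv bary_ge0.
  by apply/orP; right; lra.
have cross w t x y : 3 * t < 2 -> 1 < 3 * t ->
    bary (q (h1 (w, t))) x != 0 -> bary (h2 (w, 1 - t)) y != 0 -> (x <= y)%O.
  move=> t2 t1 /qle[u hu xu] hy; apply: le_trans xu _.
  have /order_complexP[_ cw] := supp_bary w.
  have wu := h1s _ _ _ hu; have wy := h2s _ _ _ hy.
  have : (u >=< y)%O by apply: cw; rewrite inE.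
  case: comparableP => // yu _.
  (* Otherwise the mass below [u] and the mass above [y] add up to at least 1. *)
  have mu : \sum_(z | (z < u)%O) bary w z < 2^-1 by apply: h1m hu; lra.
  have my : \sum_(z | (y < z)%O) bary w z < 2^-1 by apply: h2m hy; lra.
  suff : 1 <= \sum_(z | (z < u)%O) bary w z + \sum_(z | (y < z)%O) bary w z.
    by move: mu my; set A := \sum_(z | _) _; set B := \sum_(z | _) _; lra.
  rewrite -(sum_bary w) [X in _ <= X + _]big_mkcond [X in _ <= _ + X]big_mkcond.
  rewrite -big_split /=.
  (* Each [z] in the support is counted at least once: it is comparable to [y], so either [y < z] or
     [z <= y < u]. *)
  apply: ler_sum => z _; have [->|wz] := eqVneq (bary w z) 0.
    by do 2 case: ifP => _; rewrite ?addr0.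
  have : (z >=< y)%O by apply: cw; rewrite inE.
  have := bary_ge0 w z.
  have [_ b0 _|zu _ zy] := boolP (z < u)%O;
    first by case: ifP => _; rewrite ?addr0 // lerDl.
  rewrite add0r; case: ifPn => // /negP[].
  by apply: contraNT zu => zy'; apply: le_lt_trans yu; rewrite comparable_leNgt.
have supp y : [set v | a y v != 0]%SET \in order_complex Q.
  case: y => w t.
  have /order_complexP[sQ1 c1] := supp_bary (q (h1 (w, t))).
  have /order_complexP[sQ2 c2'] := supp_bary (h2 (w, 1 - t)).
  apply/order_complexP; split=> [x|x y].
    by rewrite inE => /aP[] [_ bx]; [apply: sQ1|apply: sQ2]; rewrite inE.
  rewrite !inE => /aP[] [tx bx] /aP[] [ty bya].
  - by apply: c1; rewrite inE.
  - by apply: le_comparable; exact: cross bx bya.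
  - by apply: ge_comparable; exact: cross bya bx.
  - by apply: c2'; rewrite inE.
have [H cH HE] := realization_map ca a0 aN0 supp.
(* At both ends the weights have total 2, which the normalization removes. *)
apply: (continuous_homotopic cH) => w; apply: bary_inj => v; rewrite HE.
- have aw u : a (w, 0) u = 2 * bary (q w) u.
    by rewrite /a /= h10 mulr0 subr0 sub0r max_r // max_l ?mul0r ?addr0 // oppr_le0.
  under eq_bigr do rewrite aw.
  by rewrite aw -mulr_sumr sum_bary mulr1 [2 * _]mulrC mulfK ?pnatr_eq0.
- have aw u : a (w, 1) u = 2 * bary w u.
    rewrite /a /= subrr h20 mulr1 max_l; last by lra.
    by rewrite mul0r add0r max_r; [congr (_ * _); lra|lra].
  under eq_bigr do rewrite aw.
  by rewrite aw -mulr_sumr sum_bary mulr1 [2 * _]mulrC mulfK ?pnatr_eq0.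
Qed.

(** * Scores of bipartitional relations *)

Lemma le_bip (X : finType) (U W : bip X) : (U <= W)%O = (val U \subset val W).
Proof. by []. Qed.

Section Score.
Context {R : realType} {X : finType}.
Implicit Types (U : {set X * X}) (x y z : X).

(* On an ordered partition into blocks, underlined or not, this is the number of
   elements in later blocks minus the number of elements in earlier blocks. *)
Definition score U x : R :=
  #|[set z | (x, z) \in U]%SET|%:R - #|[set z | (z, x) \in U]%SET|%:R.

(** Transitivity of the complement makes every out-neighbour of [y] one of [x], and every
    in-neighbour of [x] one of [y]. *)
Lemma score_le U x y : bipartitional U -> (y, x) \notin U -> score U y <= score U x.
Proof.
move=> [_ tC] yx; apply: lerB; rewrite ler_nat; apply: subset_leq_card;
  apply/fintype.subsetP => z; rewrite !inE; apply: contraTT => xz.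
- by have := tC x y z; rewrite /= !inE; apply.
- by have := tC y z x; rewrite /= !inE; apply.
Qed.

Lemma score_ge U x y : bipartitional U -> (x, y) \in U -> score U y <= score U x.
Proof.
move=> [tU _] xy; apply: lerB; rewrite ler_nat; apply: subset_leq_card;
  apply/fintype.subsetP => z; rewrite !inE => yz.
- exact: tU xy yz.
- exact: tU yz xy.
Qed.

(** The element [y] itself makes one inclusion of neighbourhoods strict: that of the in-neighbours
    if [(y, y)] is in [U], that of the out-neighbours otherwise. *)
Lemma score_lt U x y :
  bipartitional U -> (x, y) \in U -> (y, x) \notin U -> score U y < score U x.
Proof.
move=> [tU tC] xy yx.
have sr : [set z | (y, z) \in U]%SET \subset [set z | (x, z) \in U]%SET.
  by apply/fintype.subsetP => z; rewrite !inE => yz; exact: tU xy yz.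
have sc : [set z | (z, x) \in U]%SET \subset [set z | (z, y) \in U]%SET.
  by apply/fintype.subsetP => z; rewrite !inE => yz; exact: tU yz xy.
have [yy|yy] := boolP ((y, y) \in U).
  apply: ler_ltB; first by rewrite ler_nat subset_leq_card.
  rewrite ltr_nat proper_card //; apply/properP; split=> //.
  exists y; rewrite !inE //.
apply: ltr_leB; last by rewrite ler_nat subset_leq_card.
rewrite ltr_nat proper_card //; apply/properP; split=> //.
by exists y; rewrite !inE.
Qed.

Lemma mem_of_score_lt U x y : bipartitional U -> score U y < score U x ->
  (x, y) \in U /\ (y, x) \notin U.
Proof.
move=> bU lt; split.
  by apply: contraLR lt => xy; rewrite -leNgt; exact: score_le.
by apply: contraTN lt => yx; rewrite -leNgt; exact: score_ge.
Qed.

(** If the score were constant, [U] and its complement would be symmetric as well as transitive.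
    Then some [(x, x)] is in [U] and some [(a, a)] is not, and [(x, a)] can lie on neither side. *)
Lemma score_nonconstant U : bipartitional U ->
  U != finset.set0 -> U != finset.setT -> exists x y, score U y < score U x.
Proof.
move=> bU /set0Pn[[x y] xy] UT; apply: contrapT => /forallNP N.
have sym a b : (a, b) \in U -> (b, a) \in U.
  move=> ab; apply: contrapT => /negP ba.
  by have /forallNP/(_ b) := N a; apply; exact: score_lt.
have [tU tC] := bU.
have [[a b] _ ab] : exists2 p, p \in [set: X * X]%SET & p \notin U.
  by apply/fintype.subsetPn; apply: contraNN UT => TU; rewrite -finset.subTset.
have symC c d : (c, d) \notin U -> (d, c) \notin U by apply: contra => /sym.
have xx : (x, x) \in U by apply: tU xy (sym _ _ xy).
have aa : (a, a) \notin U.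
  by have := tC b a a; rewrite /= !inE; apply=> //; exact: symC.
have xa : (x, a) \notin U.
  by apply: contra aa => xa; apply: tU (sym _ _ xa) xa.
suff : (x, x) \notin U by rewrite xx.
by have := tC a x x; rewrite /= !inE; apply=> //; exact: symC.
Qed.
End Score.

(** * Heights: from weighted chains to functions on [X] *)

Section Height.
Context {R : realType} {X : finType}.
Local Notation T := (geometric_realization R (order_complex (proper_part_bip X))).
Implicit Types (w : T) (U : bip X) (x y : X).

Definition height w x : R := \sum_U bary w U * score (val U) x.

Lemma bip_valP U : bipartitional (val U).
Proof. by apply/asboolP; case: U. Qed.

Lemma height_continuous x : continuous (fun w => height w x).
Proof.
apply: continuous_sumr => U _; apply: continuous_mul; last exact: cst_continuous.
exact: bary_continuous.
Qed.

Lemma mem_of_height_lt w x y : height w y < height w x ->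
  exists2 U, bary w U != 0 & (x, y) \in val U.
Proof.
move=> lt; apply: contrapT => N; move: lt; rewrite ltNge => /negP; apply.
apply: ler_sum => U _; have [->|wU] := eqVneq (bary w U) 0; first by rewrite !mul0r.
rewrite ler_wpM2l ?bary_ge0 // leNgt; apply/negP => /mem_of_score_lt.
by case=> [|xy _]; [exact: bip_valP|apply: N; exists U].
Qed.

(** Some [U] in the support contains a pair [(x, y)] but not its reverse. A larger relation of the
    chain still contains [(x, y)], a smaller one still omits [(y, x)]; neither reverses the
    inequality of scores. *)
Lemma height_nonconstant w : exists x y, height w y < height w x.
Proof.
have /order_complexP[sQ cw] := supp_bary w.
have [U wU] := exists_bary_neq0 w.
have := sQ U; rewrite !inE => /(_ wU)/andP[U0 UT].
have [x [y lt]] := score_nonconstant (R := R) (bip_valP U) U0 UT.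
exists x, y; have [xy yx] := mem_of_score_lt (bip_valP U) lt.
rewrite /height (bigD1 U) //= [ltRHS](bigD1 U) //=; apply: ltr_leD.
  by rewrite ltr_pM2l // lt_def wU bary_ge0.
apply: ler_sum => W _; have [->|wW] := eqVneq (bary w W) 0; first by rewrite !mul0r.
rewrite ler_wpM2l ?bary_ge0 //.
have : (U >=< W)%O by apply: cw; rewrite inE.
rewrite /Order.comparable !le_bip => /orP[] /fintype.subsetP UW.
  by apply: score_ge; [exact: bip_valP|exact: UW].
by apply: score_le; [exact: bip_valP|apply: contra yx; exact: UW].
Qed.

Lemma exists_max_supp w : exists2 M, bary w M != 0 &
  forall U, bary w U != 0 -> (U <= M)%O.
Proof.
have /order_complexP[_ cw] := supp_bary w.
have [U wU] := exists_bary_neq0 w.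
have US : U \in [set V | bary w V != 0]%SET by rewrite inE.
have [M] := @exists_minimal _ (fun V W : bip X => (W < V)%O) _ U (@ltxx _ _)
  (fun b a c ab bc => lt_trans bc ab) US.
move=> MS Mmax; exists M => [|V wV]; first by move: MS; rewrite inE.
have VS : V \in [set V | bary w V != 0]%SET by rewrite inE.
by rewrite comparable_leNgt ?Mmax //; exact: cw.
Qed.
End Height.

(** * Levels: from functions on [X] to weighted chains *)

Section Levels.
Context {R : realType} {X : finType}.
Implicit Types (v : X -> R) (A : {set X}) (p q : X * X) (s : R).

(** A continuous function of [v], positive exactly when all values on [A] exceed all values off [A].
    The empty products for [A] empty or full never enter [link]. *)
Definition gap v A : R := \prod_(x in A) \prod_(y in ~: A) Num.max 0 (v x - v y).

(* The relation [fun p => s < link v p] is the ordered partition, without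
   underlined blocks, which separates the values of [v] exactly at the thresholds
   whose gap exceeds [s]. *)
Definition link v p : R :=
  \big[Num.max/0]_(A : {set X} | (p.1 \in A) && (p.2 \notin A)) gap v A.

Definition level v s : {set X * X} := [set p | s < link v p]%SET.

Lemma gap_gt0P v A :
  reflect {in A & ~: A, forall x y, v y < v x} (0 < gap v A).
Proof.
have g0 : 0 <= gap v A.
  by apply: prodr_ge0 => x _; apply: prodr_ge0 => y _; rewrite le_max lexx.
rewrite lt_def g0 andbT; apply: (iffP idP) => [/prodf_neq0 gN0 x y xA yA|vA].
  have /prodf_neq0/(_ y yA) := gN0 x xA.
  by apply: contra_neqT; rewrite -leNgt => vxy; rewrite max_l // subr_le0.
apply/prodf_neq0 => x xA; apply/prodf_neq0 => y yA.
by rewrite gt_eqF // lt_max subr_gt0 vA ?orbT.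
Qed.

Lemma link_ge0 v p : 0 <= link v p.
Proof. exact: bigmax_ge_id. Qed.

Lemma lt_linkP v p s : 0 <= s ->
  reflect (exists A, [/\ p.1 \in A, p.2 \notin A & s < gap v A]) (s < link v p).
Proof.
move=> s0; apply: (iffP idP) => [|[A [p1 p2 sA]]].
  by move=> /bigmax_gtP[|[A /andP[p1 p2] sA]]; [rewrite ltNge s0|exists A].
by apply/bigmax_gtP; right; exists A; rewrite ?p1.
Qed.

Lemma link_gt0_lt v p : 0 < link v p -> v p.2 < v p.1.
Proof.
by move=> /lt_linkP-/(_ (lexx _))[A [p1 p2 /gap_gt0P vA]]; apply: vA; rewrite ?inE.
Qed.

(** A set [A] separating [x] from [y] also separates [x] from any [z] with a smaller value than [y].
    For the complement, a set separating [x] from [z] separates [x] from [y] or [y] from [z],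
    depending on the side of [y]. *)
Lemma level_bipartitional v s : 0 <= s -> bipartitional (level v s).
Proof.
move=> s0; split=> y x z; rewrite /= !inE.
  move=> /(lt_linkP _ _ s0)[A [xA yA sA]] syz; apply/(lt_linkP _ _ s0).
  exists A; split=> //=; apply/negP => zA.
  have /gap_gt0P/(_ z y zA) := le_lt_trans s0 sA; rewrite inE => /(_ yA) yz.
  by have := link_gt0_lt (le_lt_trans s0 syz); rewrite /= ltNge ltW.
move=> xy; apply: contraNN => /(lt_linkP _ _ s0)[A [xA zA sA]].
apply/(lt_linkP _ _ s0); exists A; split=> //=.
by apply: contraNT xy => yA; apply/(lt_linkP _ _ s0); exists A.
Qed.

Lemma levelS v s s' : s <= s' -> level v s' \subset level v s.
Proof. by move=> ss'; apply/fintype.subsetP => p; rewrite !inE; exact: le_lt_trans. Qed.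

Lemma level_lt v s x y : 0 <= s -> (x, y) \in level v s -> v y < v x.
Proof. by move=> s0; rewrite inE => /(le_lt_trans s0)/link_gt0_lt. Qed.

Lemma mem_level0 v x y : v y < v x -> (x, y) \in level v 0.
Proof.
move=> yx; rewrite inE; apply/lt_linkP => //; exists [set z | v y < v z]%SET.
rewrite !inE /= ltxx; split=> //; apply/gap_gt0P => a b; rewrite !inE -leNgt => ya yb.
exact: le_lt_trans ya.
Qed.

(** The device of [gap] again, now on [X * X] with [link v] in place of [v]: the weight of a proper
    [U] is nonzero exactly when a threshold of [link v] cuts out [U]. It is continuous in [v], and
    its support is a chain because levels are nested. *)
Definition weight v (U : bip X) : R :=
  if U \in proper_part_bip X
  then \prod_(p in val U) \prod_(q in ~: val U) Num.max 0 (link v p - link v q)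
  else 0.

Lemma weight_ge0 v U : 0 <= weight v U.
Proof.
rewrite /weight; case: ifP => // _.
by apply: prodr_ge0 => x _; apply: prodr_ge0 => y _; rewrite le_max lexx.
Qed.

Lemma weight_neq0 v U : weight v U != 0 ->
  U \in proper_part_bip X /\ exists2 s, 0 <= s & val U = level v s.
Proof.
rewrite /weight; case: ifPn => [UQ /prodf_neq0 wU|]; last by rewrite eqxx.
split=> //; pose s := \big[Num.max/0]_(q in ~: val U) link v q.
exists s; first exact: bigmax_ge_id.
have lt p q : p \in val U -> q \notin val U -> link v q < link v p.
  move=> pU qU; have /prodf_neq0/(_ q) := wU p pU; rewrite inE => /(_ qU).
  by apply: contra_neqT; rewrite -leNgt => vxy; rewrite max_l // subr_le0.
(* A pair outside [U] guarantees that links on [U] also exceed the default value 0 of the maximum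
   [s]. *)
have [q0 _ q0U] : exists2 p, p \in [set: X * X]%SET & p \notin val U.
  apply/fintype.subsetPn; move: UQ; rewrite inE => /andP[_].
  by apply: contraNN => TU; rewrite -finset.subTset.
apply/setP => p; rewrite inE; have [pU|pU] := boolP (p \in val U); symmetry.
  apply/bigmax_ltP; split=> [|q]; last by rewrite inE => /lt; apply.
  by apply: le_lt_trans (lt _ _ pU q0U); exact: link_ge0.
apply/negbTE; rewrite -leNgt; apply: le_bigmax_cond; by rewrite inE.
Qed.

(** The witness is [level v 0], which contains [(x, y)] and misses the diagonal, hence is proper. *)
Lemma exists_weight_neq0 v x y : v y < v x -> exists U, weight v U != 0.
Proof.
move=> yx; have bl := level_bipartitional v (lexx 0).
exists (Bip (introT (asboolP _) bl)).
rewrite /weight ifT; last first.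
  rewrite inE /=; apply/andP; split.
    by apply/set0Pn; exists (x, y); exact: mem_level0.
  apply/negP => /eqP lT; have : (x, x) \in level v 0 by rewrite lT inE.
  by move/level_lt => /(_ (lexx _)); rewrite ltxx.
apply/prodf_neq0 => p; rewrite inE => p0; apply/prodf_neq0 => q.
rewrite !inE -leNgt => q0; rewrite gt_eqF // lt_max subr_gt0.
by rewrite (le_lt_trans q0 p0) orbT.
Qed.

Lemma supp_weight v :
  [set U | weight v U != 0]%SET \in order_complex (proper_part_bip X).
Proof.
apply/order_complexP; split=> [U|U W]; rewrite !inE.
  by move=> /weight_neq0[]; rewrite inE.
move=> /weight_neq0[_ [s _ Us]] /weight_neq0[_ [s' _ Ws']].
rewrite /Order.comparable !le_bip Us Ws'.
by have [ss'|/ltW ss'] := leP s s'; rewrite (levelS v ss') ?orbT.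
Qed.

Lemma weight_continuous (Y : topologicalType) (v : Y -> X -> R) U :
  (forall x, continuous (v ^~ x)) -> continuous (fun y => weight (v y) U).
Proof.
move=> cv; rewrite /weight; case: (U \in _); last exact: cst_continuous.
have cgap A : continuous (fun y => gap (v y) A).
  apply: continuous_prodr => x _; apply: continuous_prodr => z _.
  by apply: continuous_maxr; [exact: cst_continuous|exact: continuous_sub].
have clink p : continuous (fun y => link (v y) p) by exact: continuous_bigmaxr.
apply: continuous_prodr => p _; apply: continuous_prodr => q _.
by apply: continuous_maxr; [exact: cst_continuous|exact: continuous_sub].
Qed.
End Levels.

(** * Coordinates for functions on [X] modulo constants, normalized to vanish at [x0] *)

Lemma enum_punctured (X : finType) (x0 : X) :
  exists2 e : 'I_#|X|.-1 -> X, injective e & forall x, (x \in codom e) = (x != x0).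
Proof.
have cX : #|X|.-1 = #|[set~ x0]%SET| by rewrite cardsC1.
exists (fun i => enum_val (cast_ord cX i)).
  by move=> i j /enum_val_inj/cast_ord_inj.
move=> x; apply/idP/idP => [/codomP[i ->]|xx0].
  by have := enum_valP (cast_ord cX i); rewrite !inE.
have xS : x \in [set~ x0]%SET by rewrite !inE.
apply/codomP; exists (cast_ord (esym cX) (enum_rank_in xS x)).
by rewrite cast_ordKV enum_rankK_in.
Qed.

Lemma sphere_sum_sqr (R : realType) n (u : unit_sphere R n) : \sum_i sval u 0 i ^+ 2 = 1.
Proof. by case: u => u /= /set_mem. Qed.

Lemma sphere_inj (R : realType) n (u u' : unit_sphere R n) :
  sval u 0 =1 sval u' 0 -> u = u'.
Proof. by move=> uu'; apply: val_inj; apply/rowP => i; exact: uu'. Qed.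

Section Extension.
Context {R : realType} {X : finType} {n : nat} (e : 'I_n -> X) (x0 : X).
Context (e_inj : injective e) (codom_e : forall x, (x \in codom e) = (x != x0)).
Implicit Types c : 'I_n -> R.

(** The sum has one term off [x0] and none at [x0]; this form makes linearity and continuity in [c]
    immediate. *)
Definition extend c x : R := \sum_(i | e i == x) c i.

Lemma extend_e c i : extend c (e i) = c i.
Proof.
by rewrite /extend (eq_bigl (pred1 i)) ?big_pred1_eq // => j; rewrite (inj_eq e_inj).
Qed.

Lemma extend_base c : extend c x0 = 0.
Proof.
rewrite /extend big_pred0 // => i; apply/negbTE.
by rewrite -codom_e codom_f.
Qed.

Lemma extend_restrict (h : X -> R) (k : R) x :
  extend (fun i => k * (h (e i) - h x0)) x = k * (h x - h x0).
Proof.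
have [->|] := eqVneq x x0; first by rewrite extend_base subrr mulr0.
by rewrite -codom_e => /codomP[i ->]; rewrite extend_e.
Qed.

Lemma exists_extend_lt c i : c i != 0 -> exists x y, extend c y < extend c x.
Proof.
move=> ci; have [lt|gt|eq] := ltgtP (extend c (e i)) (extend c x0).
- by exists x0, (e i).
- by exists (e i), x0.
- by move: ci; rewrite -extend_e eq extend_base eqxx.
Qed.
End Extension.

(** * The homotopy equivalence *)

Theorem theorem9p3 (R : realType) (X : finType) (hX : (0 < #|X|)%N) :
  homotopy_equivalent R
    (geometric_realization R (order_complex (proper_part_bip X)))
    (unit_sphere R #|X|.-1).
Proof.
have [x0 _] := card_gt0P hX.
have [e ei ec] := enum_punctured x0.
set T := geometric_realization _ _; set S := unit_sphere _ _.
(* Subtracting the height at [x0] and scaling to norm 1 preserve strict inequalities between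
   heights; besides continuity, this is all that is retained of [f]. *)
have [f cf fE] : exists2 f : T -> S, continuous f &
    forall w x y, height w y < height w x <->
      extend e (sval (f w) 0) y < extend e (sval (f w) 0) x.
  pose a (w : T) i : R := height w (e i) - height w x0.
  have ca i : continuous (a ^~ i) by apply: continuous_sub; exact: height_continuous.
  have aN0 w : exists i, a w i != 0.
    apply: contrapT => /forallNP a0.
    have h0 x : height w x = height w x0.
      have [->//|] := eqVneq x x0; rewrite -ec => /codomP[i ->].
      by apply/eqP; rewrite -subr_eq0; apply/negPn/negP; exact: a0.
    by have [x [y]] := height_nonconstant w; rewrite !h0 ltxx.
  have [f cf fE] := sphere_map ca aN0; exists f => // w x y.
  pose k := (Num.sqrt (\sum_j a w j ^+ 2))^-1.
  have k0 : 0 < k.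
    rewrite invr_gt0 sqrtr_gt0; have [i ai] := aN0 w.
    rewrite (bigD1 i) //= ltr_wpDr ?exprn_even_gt0 ?sumr_ge0 // => j _.
    by rewrite sqr_ge0.
  have -> : sval (f w) 0 = fun i => k * (height w (e i) - height w x0).
    by apply: funext => i; rewrite fE mulrC.
  by rewrite !(extend_restrict ei ec) ltr_pM2l // ltrD2r.
pose v (u : S) := extend e (sval u 0).
have cv x : continuous (v ^~ x).
  by apply: continuous_sumr => i _; exact: sphere_coord_continuous.
have [g cg gE] : exists2 g : S -> T, continuous g &
    forall u U, bary (g u) U != 0 -> weight (v u) U != 0.
  have wN0 u : exists U, weight (v u) U != 0.
    have [i ui] : exists i, sval u 0 i != 0.
      apply: contrapT => /forallNP u0; have := sphere_sum_sqr u.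
      rewrite big1 => [/esym/eqP|i _]; first by rewrite oner_eq0.
      by have /negP := u0 i; rewrite negbK => /eqP->; rewrite expr0n.
    have [x [y lt]] := exists_extend_lt ei ec ui.
    exact: exists_weight_neq0 lt.
  have [g cg gE] := realization_map (fun U => weight_continuous (U := U) cv)
    (fun u => weight_ge0 (v u)) wN0 (fun u => supp_weight (v u)).
  exists g => // u U; rewrite gE mulf_eq0 negb_or => /andP[] //.
have gv u U x y : bary (g u) U != 0 -> (x, y) \in val U -> v u y < v u x.
  by move=> /gE/weight_neq0[_ [s s0 ->]]; exact: level_lt.
exists f, g; split=> //.
  (* A pair in a relation [U] of the support of [g (f w)] is one along which the height of [w] is
     strictly ordered, so it lies in some relation of the support of [w], hence in the largest one,
     [M]. *)
  apply: dominated_homotopic_id => [|w U gU].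
    by move=> w; apply: continuous_comp; [exact: cf|exact: cg].
  have [M wM Mmax] := exists_max_supp w; exists M => //.
  rewrite le_bip; apply/fintype.subsetP => -[x y] /(gv _ _ _ _ gU)/fE.
  by move=> /mem_of_height_lt[W /Mmax]; rewrite le_bip => /fintype.subsetP; apply.
(* The segment from [f (g u)] to [u], with coefficients truncated at 0 so that they are nonnegative
   at all real times. *)
pose a (y : S * R) i :=
  Num.max 0 (1 - y.2) * sval (f (g y.1)) 0 i + Num.max 0 y.2 * sval y.1 0 i.
have c2 : continuous (fun y : S * R => y.2) by move=> y; exact: cvg_snd.
have ck (k : R) : continuous (fun y : S * R => k) by exact: cst_continuous.
have ca i : continuous (a ^~ i).
  apply: continuous_add; apply: continuous_mul.
  - by apply: continuous_maxr => //; exact: continuous_sub.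
  - move=> y; apply: (@continuous_comp (S * R)%type S R (fun z => f (g z.1))
      (fun u => sval u 0 i)); last exact: sphere_coord_continuous.
    apply: (@continuous_comp _ T S (fun z : S * R => g z.1) f); last exact: cf.
    by apply: continuous_comp; [exact: cvg_fst|exact: cg].
  - exact: continuous_maxr.
  - move=> y; apply: (@continuous_comp (S * R)%type S R fst
      (fun u => sval u 0 i)); first exact: cvg_fst.
    exact: sphere_coord_continuous.
have aN0 y : exists i, a y i != 0.
  case: y => u t; apply: contrapT => /forallNP a0.
  (* A pair strictly ordered by the height of [g u] lies in a relation supporting [g u], so
     [f (g u)] and [u] both order it strictly in the same direction, and so does every point of the
     segment. *)
  have [x [y hlt]] := height_nonconstant (g u).
  have [U gU xy] := mem_of_height_lt hlt.
  have uxy := gv _ _ _ _ gU xy; have /fE fxy := hlt.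
  have aE z : extend e (a (u, t)) z = Num.max 0 (1 - t) * v (f (g u)) z +
      Num.max 0 t * v u z.
    by rewrite /v /extend big_split /= -!mulr_sumr.
  have az z : extend e (a (u, t)) z = 0.
    by rewrite /extend big1 // => i _; apply/eqP/negPn/negP; exact: a0.
  suff : extend e (a (u, t)) y < extend e (a (u, t)) x by rewrite !az ltxx.
  rewrite !aE; have [t0|t0] := leP t 0.
    by rewrite !mul0r !addr0 ltr_pM2l // lt_max; apply/orP; right; lra.
  apply: ler_ltD; last by rewrite ltr_pM2l.
  by rewrite ler_wpM2l ?(ltW fxy) // le_max lexx.
have [H cH HE] := sphere_map ca aN0.
apply: (continuous_homotopic cH) => u; apply: sphere_inj => i; rewrite HE.
- have aw j : a (u, 0) j = sval (f (g u)) 0 j.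
    by rewrite /a /= subr0 maxxx mul0r addr0 max_r // mul1r.
  under eq_bigr do rewrite aw.
  by rewrite aw sphere_sum_sqr sqrtr1 divr1.
- have aw j : a (u, 1) j = sval u 0 j.
    by rewrite /a /= subrr maxxx mul0r add0r max_r // mul1r.
  under eq_bigr do rewrite aw.
  by rewrite aw sphere_sum_sqr sqrtr1 divr1.
Qed.
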